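(* Let $z\in(0,1-1/\sqrt2)$. Assume that there is $a>0$ such that for all $\xi>0$ and all (finite measurable) partitions $m$ of $\mathcal X$, $$\mathbb P[\mathcal X^2(m)\ge a(|m|+\xi)]\le e^{-\xi},$$ and that there is $\delta\ge1$ such that $|m\vee m'|\le\delta(|m|\vee|m'|)$ for all $m,m'\in\mathcal M$. Set $\tau=20az^{-2}$. Let $\{\Delta_m,m\in\mathcal M\}$ satisfy $\Sigma=\sum_{m\in\mathcal M}e^{-\Delta_m}<+\infty$ and $\Delta_m\ge1$ for all $m\in\mathcal M$. Consider a family $\{\hat s_\lambda,\lambda\in\Lambda\}$ of estimators of $s$ with values in $\mathbb S$. If $\mathrm{pen}:\mathbb S\to\mathbb R_+$ is such that $$\mathrm{pen}(t)\ge z\tau\inf_{m\in\mathcal M(t)}(\delta|m|+\Delta_m)\quad\text{for all }t\in\mathbb S,$$ then the estimator $\tilde s=\hat s_{\hat\lambda}$ selected by the selection procedure (described in the context) satisfies, for some constant $C>0$ depending on $z$ only, $$C\,\mathbb E[H^2(s,\tilde s)]\le\mathbb E\left[\inf_{\lambda\in\Lambda}\left[H^2(s,\hat s_\lambda)+\mathrm{pen}(\hat s_\lambda)\right]\right]+\tau(\Sigma^2\vee1).$$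
   Context: Setting. $N$ is a random measure on a probability space $(\Omega,\mathcal T,\mathbb P)$ with values in the positive measures on a measured space $(\mathcal X,\mathcal A,\mu)$, with $\mathbb E[N(A)]=\int_As\,d\mu<+\infty$ for all $A\in\mathcal A$, where $s\ge0$ is measurable. $\mathcal L$ is the set of nonnegative measurable integrable functions on $(\mathcal X,\mathcal A,\mu)$; $\mathcal L_0\subset\mathcal L$ is a known subset containing $s$. $H^2(t,t')=\frac12\int_{\mathcal X}(\sqrt t-\sqrt{t'})^2d\mu$. $\mathcal M$ is an at most countable family of (finite measurable) partitions of $\mathcal X$; for $m\in\mathcal M$, $S_m$ is the (nonvoid) set of elements of $\mathcal L_0$ that are constant on each element of $m$: $S_m=\{\sum_{I\in m}a_I\mathbf 1_I:\ (a_I)\in\mathbb R^{|m|}\}\cap\mathcal L_0$. $\mathbb S=\bigcup_{m\in\mathcal M}S_m$ and $\mathcal M(t)=\{m\in\mathcal M:t\in S_m\}$. For partitions $m,m'$: $m\vee m'=\{I\cap I':\ (I,I')\in m\times m'\}$ and $\mathcal X^2(m)=\sum_{I\in m}\left(\sqrt{N(I)}-\sqrt{\mathbb E(N(I))}\right)^2$. $|m|$ is the cardinality of $m$. $\{\hat s_\lambda,\lambda\in\Lambda\}$ is an at most countable family; estimators are measurable functions of $N$. Selection procedure. Let $\rho_r(N,t)=\frac12\left[\int_{\mathcal X}\sqrt{tr}\,d\mu+\int_{\mathcal X}\sqrt{t/r}\,dN\right]$ (conventions $0/0=0$, $a/0=+\infty$ for $a>0$). For $\hat s_\lambda\ne\hat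 s_{\lambda'}$ put, with $r=(\hat s_\lambda+\hat s_{\lambda'})/2$, $$\mathbf T(N,\hat s_\lambda,\hat s_{\lambda'})=\left[\rho_r(N,\hat s_{\lambda'})-\tfrac12\int_{\mathcal X}\hat s_{\lambda'}d\mu-\mathrm{pen}(\hat s_{\lambda'})\right]-\left[\rho_r(N,\hat s_\lambda)-\tfrac12\int_{\mathcal X}\hat s_\lambda d\mu-\mathrm{pen}(\hat s_\lambda)\right].$$ Let $\mathcal E(\hat s_\lambda)$ be the set of those $\hat s_{\lambda'}\neq\hat s_\lambda$ with $\mathbf T(N,\hat s_\lambda,\hat s_{\lambda'})\ge0$, and $\mathcal D(\hat s_\lambda)=\sup\{H^2(\hat s_\lambda,\hat s_{\lambda'}):\hat s_{\lambda'}\in\mathcal E(\hat s_\lambda)\}$ if $\mathcal E(\hat s_\lambda)\ne\varnothing$, $\mathcal D(\hat s_\lambda)=0$ otherwise. Then $\hat\lambda$ is any element of $\Lambda$ such that $\mathcal D(\hat s_{\hat\lambda})\le\mathcal D(\hat s_\lambda)+\tau$ for all $\lambda\in\Lambda$. *)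

(* Defs.v *)
From HB Require Import structures.
From mathcomp Require Import all_boot all_order all_algebra.
From mathcomp Require Import finmap.
From mathcomp Require Import all_classical all_reals all_analysis.
From mathcomp Require Import measurable_realfun.

Set Implicit Arguments.
Unset Strict Implicit.
Unset Printing Implicit Defensive.

Import Order.TTheory GRing.Theory Num.Theory.
Import numFieldNormedType.Exports.

Local Open Scope classical_set_scope.
Local Open Scope ring_scope.

(* Library conventions used throughout.
   - For a nonnegative f, [\int[mu]_(x in A) f x] is always defined, as the
     supremum of the integrals of the nonnegative simple functions below f; for
     a measurable f this is the usual integral.
   - On [\bar R], [0^-1 = +oo] and [0 * +oo = 0]: hence [0 / 0 = 0] and
     [a / 0 = +oo] for [a > 0].  Also [sqrte +oo = +oo]. *)

Section Partitions.
Context {d : measure_display} {X : measurableType d}.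

(* The cells of a partition are nonempty. *)
Definition finite_partition (m : set (set X)) : Prop :=
  [/\ finite_set m, m `<=` measurable & partition m id [set: X]].

Definition ncells (m : set (set X)) : nat := #|` fset_set m|.

(* Empty intersections are not cells, so that the join of two partitions is
   again a partition. *)
Definition join_partition (m m' : set (set X)) : set (set X) :=
  [set I `&` I' | I in m & I' in m'] `\ set0.

End Partitions.

Section Models.
Context {R : realType} {d : measure_display} {X : measurableType d}.

Definition nonneg_integrable (mu : {measure set X -> \bar R}) : set (X -> R) :=
  [set t | (forall x, 0 <= t x) /\ mu.-integrable [set: X] (EFin \o t)].

(* S_m; the coefficients are indexed by all sets, only those of the cells of m
   matter. *)
Definition piecewise_constant_model (L0 : set (X -> R)) (m : set (set X)) :
    set (X -> R) :=
  [set t | exists a : set X -> R,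
     t = (fun x => \sum_(I \in m) a I * \1_I x)] `&` L0.

(* M(t) *)
Definition models_containing (L0 : set (X -> R)) (M : set (set (set X)))
    (t : X -> R) : set (set (set X)) :=
  [set m | M m /\ piecewise_constant_model L0 m t].

(* The union of the S_m *)
Definition all_models (L0 : set (X -> R)) (M : set (set (set X))) :
    set (X -> R) :=
  \bigcup_(m in M) piecewise_constant_model L0 m.

End Models.

Section Hellinger.
Context {R : realType} {d : measure_display} {X : measurableType d}.
Variable mu : {measure set X -> \bar R}.
Local Open Scope ereal_scope.

Definition sq_hellinger (t t' : X -> R) : \bar R :=
  (2^-1)%:E *
  \int[mu]_x ((Num.sqrt (t x) - Num.sqrt (t' x)) ^+ 2)%R%:E.

Definition rho (r : X -> R) (nu : {measure set X -> \bar R}) (t : X -> R) :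
    \bar R :=
  (2^-1)%:E * (\int[mu]_x (Num.sqrt (t x * r x))%:E +
               \int[nu]_x sqrte ((t x)%:E / (r x)%:E)).

(* T(nu, t, t'), nu being the observed measure *)
Definition test_statistic (pen : (X -> R) -> R)
    (nu : {measure set X -> \bar R}) (t t' : X -> R) : \bar R :=
  let r := fun x => ((t x + t' x) / 2)%R in
  (rho r nu t' - (2^-1)%:E * \int[mu]_x (t' x)%:E - (pen t')%:E) -
  (rho r nu t - (2^-1)%:E * \int[mu]_x (t x)%:E - (pen t)%:E).

Section Selection.
Variables (pen : (X -> R) -> R) (nu : {measure set X -> \bar R}).
(* [est] is the set of values taken by the estimators at the observation. *)
Variable est : set (X -> R).

(* E(t) *)
Definition preferred (t : X -> R) : set (X -> R) :=
  [set t' | [/\ est t', t' <> t & 0 <= test_statistic pen nu t t']].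

(* D(t) *)
Definition selection_crit (t : X -> R) : \bar R :=
  if preferred t == set0 then 0
  else ereal_sup [set sq_hellinger t t' | t' in preferred t].

End Selection.

End Hellinger.

Section RandomMeasure.
Context {R : realType} {dO : measure_display} {Om : measurableType dO}.
Context {d : measure_display} {X : measurableType d}.
Variable N : R.-ker Om ~> X.

(* X^2(m) at the sample point w *)
Definition chi2 (P : probability Om R) (m : set (set X)) (w : Om) : \bar R :=
  (\sum_(I \in m) (sqrte (N w I) - sqrte (\int[P]_w' N w' I)) ^+ 2)%E.

(* These events generate the sigma-algebra of the observation N. *)
Definition observation_events : set (set Om) :=
  [set [set w | B (N w A)] |
     A in (measurable : set (set X)) & B in (measurable : set (set (\bar R)))].

(* Measurable functions of N: the space of functions X -> R carries the
   sigma-algebra generated by the evaluations.  For estimators with values in a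
   countable union of models this is equivalent to joint measurability in
   (w, x). *)
Definition is_estimator (e : Om -> X -> R) : Prop :=
  forall x, measurable_fun [set: g_sigma_algebraType observation_events]
    (fun w : g_sigma_algebraType observation_events => e w x).

(* lhat is an index selected, up to tau, from the family shat. *)
Definition is_selected (mu : {measure set X -> \bar R}) (pen : (X -> R) -> R)
    (tau : R) (Lam : Type) (shat : Lam -> Om -> X -> R) (lhat : Om -> Lam) :
    Prop :=
  forall w l,
    let D := selection_crit mu pen (N w) (range (fun l' => shat l' w)) in
    (D (shat (lhat w) w) <= D (shat l w) + tau%:E)%E.

End RandomMeasure.

(* Main.v *)
Require Import Defs.
From HB Require Import structures.
From mathcomp Require Import all_boot all_order all_algebra.
From mathcomp Require Import all_classical all_reals all_analysis.
From mathcomp Require Import measurable_realfun.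
From mathcomp Require Import finmap ring lra.

Import Order.TTheory GRing.Theory Num.Theory.
Import numFieldNormedType.Exports.

Local Open Scope classical_set_scope.
Local Open Scope ring_scope.

(** The theorem is a statement about robust tests, and its proof separates a
deterministic analysis of the test from one probabilistic estimate.

_The test._  Let [t], [u] be two candidates, [r] their mean, and
[S = H^2(s,t) + H^2(s,u)].  Replace the observed measure by its intensity
[s mu] in [T(nu, t, u)].  Up to a common constant, [rho_r(s, t) - int t / 2] is
[- H^2(s, t)] plus the nonnegative error
[int sqrt(t / r) (sqrt s - sqrt r)^2 / 2].  As [t / r <= 2] and [H^2] is
convex, this error is at most [S / sqrt 2], so that the test at the true
intensity is at most
[(1 + 1 / sqrt 2) H^2(s,t) - (1 - 1 / sqrt 2) H^2(s,u)].  The difference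
between the two tests is the integral of
[psi = sqrt(u / r) - sqrt(t / r)] against [nu - s mu] (halved).  Since [psi] is
constant on the cells of the join [m] of the two partitions, and
[n - e = (sqrt n - sqrt e)^2 + 2 sqrt e (sqrt n - sqrt e)], this difference is
bounded by a multiple of [chi2(m)] plus [z S]; the condition
[z < 1 - 1 / sqrt 2] keeps the coefficient of [- H^2(s,u)] positive.  These two
steps are [midpoint_pointwise_bound], which is integrated against [mu], and
[cell_fluctuation], which is summed over the cells; they are combined in
[preferred_hellinger_bound].

_The noise._  The deviation inequality is applied to all joins of two
partitions of [M], with [xi = Delta_m + Delta_m' + k].  The sum of the
indicators of the exceptional events over [m], [m'] and [k : nat] is a random
variable [G] with [E G <= 2 Sigma^2], and wherever [G] is finite every
[chi2] is less than [a (|m v m'| + Delta_m + Delta_m' + G)]; this is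
[exponential_tails_dominated].  The growth condition on joins and the lower
bound on the penalty turn this into
[pen t + pen u + tau G] ([noise_constant_le]): the noise due to [u] is absorbed
by its own penalty.

_The selection._  Consequently a candidate [u] that the test prefers to [t]
satisfies [kappa H^2(s,u) <= 2 H^2(s,t) + 2 pen t + tau G], where
[kappa = 1 - 1 / sqrt 2 - z].  Hence [D(t)] is small when [t] is good, and as
one of any two candidates is preferred to the other, the triangle inequality
gives [(kappa / 14) H^2(s, selected) <= H^2(s,t) + pen t + tau (1 + G)] for
every candidate [t] ([selected_hellinger_bound]).

_Integration._  The selected index and the penalty may depend on the
observation in a nonmeasurable way, so the integrals in the risk bound are lower
integrals.  The measurability of [G] suffices to split the integral of the
right-hand side ([integral_le_addr_measurable]). *)

(** * Inequalities between real numbers *)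

Lemma sqrt2_bounds (R : realType) :
  [/\ (Num.sqrt 2 : R) ^+ 2 = 2, 1 < (Num.sqrt 2 : R) & (Num.sqrt 2 : R) < 3 / 2].
Proof.
have w2 : (Num.sqrt 2 : R) ^+ 2 = 2 by rewrite sqr_sqrtr.
have w0 : 0 <= (Num.sqrt 2 : R) by rewrite sqrtr_ge0.
by split => //; nra.
Qed.

(** The integrand of the comparison of the test at the true intensity with the
Hellinger distances.  The term [eta (p - q)^2 s] on the left is the variance
that bounds the fluctuations of the test, see [cell_fluctuation]; it is added
here because it is controlled by the same two squares.  Stated with all terms
nonnegative on both sides, the inequality can be integrated term by term. *)
Lemma midpoint_pointwise_bound (R : realType) (eta s t u : R) (r := (t + u) / 2)
    (p := Num.sqrt (u / r)) (q := Num.sqrt (t / r)) :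
  0 <= eta -> 0 <= s -> 0 <= t -> 0 <= u ->
  Num.sqrt (u * r) + p * s + t + eta * ((p - q) ^+ 2 * s)
    + (1 - Num.sqrt 2 / 2 - 6 * eta) * (Num.sqrt s - Num.sqrt u) ^+ 2
  <= Num.sqrt (t * r) + q * s + u
    + (1 + Num.sqrt 2 / 2 + 6 * eta) * (Num.sqrt s - Num.sqrt t) ^+ 2.
Proof.
move=> eta0 s0 t0 u0.
have [w2 w1 w32] := sqrt2_bounds R; set w := Num.sqrt 2 in w2 w1 w32 *.
have r0 : 0 <= r by rewrite /r; lra.
have rE : r = (t + u) / 2 by [].
rewrite /p /q; clear p q; move: r r0 rE => r r0 rE; rewrite !sqrtrM// !sqrtrV//.
set a := Num.sqrt s; set b := Num.sqrt t; set c := Num.sqrt u.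
set rr := Num.sqrt r.
have a0 : 0 <= a by rewrite sqrtr_ge0.
have b0 : 0 <= b by rewrite sqrtr_ge0.
have c0 : 0 <= c by rewrite sqrtr_ge0.
have rr0 : 0 <= rr by rewrite sqrtr_ge0.
have -> : s = a ^+ 2 by rewrite sqr_sqrtr.
have Et : t = b ^+ 2 by rewrite sqr_sqrtr.
have Eu : u = c ^+ 2 by rewrite sqr_sqrtr.
have Er : rr ^+ 2 = (b ^+ 2 + c ^+ 2) / 2.
  by rewrite sqr_sqrtr// rE Et Eu; nra.
rewrite Et Eu.
have bc2 : 0 <= (b - c) ^+ 2 by exact: sqr_ge0.
have bcr : b + c <= 2 * rr.
  by rewrite -ler_sqr ?nnegrE; nra.
pose x2 := (a - b) ^+ 2; pose y2 := (a - c) ^+ 2.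
have x20 : 0 <= x2 by exact: sqr_ge0.
have y20 : 0 <= y2 by exact: sqr_ge0.
have mid : (a - rr) ^+ 2 <= (x2 + y2) / 2 by rewrite /x2 /y2; nra.
rewrite -/x2 -/y2.
(* For [r = 0] both ratios are [0 / 0 = 0], and [t = u = 0]. *)
have [rr_eq0|rr_neq0] := eqVneq rr 0.
  have bE : b = 0 by nra.
  have cE : c = 0 by nra.
  have a2 : 0 <= a ^+ 2 by exact: sqr_ge0.
  have ea2 : 0 <= eta * a ^+ 2 by rewrite mulr_ge0.
  by rewrite /x2 /y2 bE cE rr_eq0 !(mul0r, mulr0, subr0, expr0n) /=; nra.
pose P := c / rr; pose Q := b / rr.
have cP : c = P * rr by rewrite /P mulfVK.
have bQ : b = Q * rr by rewrite /Q mulfVK.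
rewrite -/P -/Q.
have P0 : 0 <= P by rewrite divr_ge0.
have Q0 : 0 <= Q by rewrite divr_ge0.
have rrgt0 : 0 < rr by rewrite lt_neqAle eq_sym rr_neq0.
have PQ2 : P ^+ 2 + Q ^+ 2 = 2.
  apply: (mulIf (expf_neq0 2 rr_neq0)); move: Er; rewrite cP bQ; nra.
have Pw : P <= w by rewrite -ler_sqr ?nnegrE ?w2; nra.
(* The test score at the true intensity is minus the squared distance to it, up
   to the error [P (a - rr)^2]. *)
have E1 : c * rr + P * a ^+ 2 = a ^+ 2 + c ^+ 2 - y2 + P * (a - rr) ^+ 2.
  by rewrite /y2 cP; ring.
have E2 : b * rr + Q * a ^+ 2 = a ^+ 2 + b ^+ 2 - x2 + Q * (a - rr) ^+ 2.
  by rewrite /x2 bQ; ring.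
have sq0 : 0 <= (a - rr) ^+ 2 by exact: sqr_ge0.
have main : P * (a - rr) ^+ 2 <= w / 2 * (x2 + y2).
  apply: (@le_trans _ _ (w * (a - rr) ^+ 2)); first by rewrite ler_wpM2r.
  by rewrite mulrAC -mulrA ler_wpM2l//; lra.
have K2 : (P - Q) ^+ 2 <= 2.
  have : 0 <= P * Q by rewrite mulr_ge0.
  by rewrite (_ : (P - Q) ^+ 2 = P ^+ 2 + Q ^+ 2 - 2 * (P * Q)); [lra|ring].
have psi : (P - Q) ^+ 2 * a ^+ 2 <= 6 * (x2 + y2).
  have h : a ^+ 2 <= 2 * (a - rr) ^+ 2 + 2 * rr ^+ 2.
    have : 0 <= (a - 2 * rr) ^+ 2 by exact: sqr_ge0.
    by rewrite !sqrrB; nra.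
  have h1 : (P - Q) ^+ 2 * (a - rr) ^+ 2 <= 2 * (a - rr) ^+ 2.
    by rewrite ler_wpM2r.
  have h2 : (P - Q) ^+ 2 * rr ^+ 2 <= 2 * (x2 + y2).
    rewrite -exprMn mulrBl -cP -bQ /x2 /y2.
    have : 0 <= ((a - b) + (a - c)) ^+ 2 by exact: sqr_ge0.
    by rewrite !sqrrB !sqrrD; nra.
  have : (P - Q) ^+ 2 * a ^+ 2 <= (P - Q) ^+ 2 * (2 * (a - rr) ^+ 2 + 2 * rr ^+ 2).
    by rewrite ler_wpM2l ?sqr_ge0.
  by rewrite mulrDr ![_ * (2 * _)]mulrCA; lra.
have := ler_wpM2l eta0 psi.
have : 0 <= Q * (a - rr) ^+ 2 by rewrite mulr_ge0.
by move=> h1 h2; nra.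
Qed.

(** With [n] the observed and [e] the expected mass of a cell, this expands
[n - e] in [sqrt n - sqrt e] and applies Young's inequality to the cross term:
no absolute value, hence no subtraction of integrals, is involved. *)
Lemma cell_fluctuation (R : realType) (eta p q n e : R) :
  0 < eta -> 0 <= p -> p <= Num.sqrt 2 -> 0 <= q -> 0 <= n -> 0 <= e ->
  p * n + q * e <= q * n + p * e + eta * ((p - q) ^+ 2 * e)
    + (Num.sqrt 2 + eta^-1) * (Num.sqrt n - Num.sqrt e) ^+ 2.
Proof.
move=> eta0 p0 pw q0 n0 e0.
rewrite -{1 2}[n]sqr_sqrtr// -{1 2 3}[e]sqr_sqrtr//.
set N := Num.sqrt n; set E := Num.sqrt e; set w := Num.sqrt 2 in pw *.
set x := N - E; have -> : N = x + E by rewrite /x; ring.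
have h1 : (p - q) * x ^+ 2 <= w * x ^+ 2 by rewrite ler_wpM2r ?sqr_ge0//; lra.
have h2 : 2 * ((p - q) * E * x) <= eta * ((p - q) ^+ 2 * E ^+ 2) + eta^-1 * x ^+ 2.
  have : 0 <= eta * ((p - q) * E - eta^-1 * x) ^+ 2.
    by rewrite mulr_ge0 ?sqr_ge0// ltW.
  rewrite (_ : eta * _ = eta * ((p - q) ^+ 2 * E ^+ 2) + eta^-1 * x ^+ 2
    - 2 * ((p - q) * E * x)); first lra.
  by field; rewrite gt_eqF.
nra.
Qed.

(** * Integrals of nonnegative real functions *)

Section Integrals.
Context {R : realType} {d : measure_display} {X : measurableType d}.
Implicit Types (mu : {measure set X -> \bar R}) (f g : X -> R) (m : set (set X)).

Lemma nonneg_integrable_integrable mu f :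
  nonneg_integrable mu f -> mu.-integrable [set: X] (EFin \o f).
Proof. by case. Qed.

Lemma nonneg_integrable_measurable mu f :
  nonneg_integrable mu f -> measurable_fun [set: X] f.
Proof. by case=> _ /measurable_int /measurable_EFinP. Qed.

Lemma nonneg_integrable_le mu f g : measurable_fun [set: X] f ->
  (forall x, 0 <= f x <= g x) -> nonneg_integrable mu g ->
  nonneg_integrable mu f.
Proof.
move=> mf fg [g0 ig]; split; first by move=> x; have /andP[] := fg x.
apply: (le_integrable _ _ _ ig) => //; first exact/measurable_EFinP.
move=> x _ /=; have /andP[f0 fgx] := fg x.
by rewrite lee_fin !ger0_norm// (le_trans f0).
Qed.

Lemma nonneg_integrableD mu f g : nonneg_integrable mu f ->
  nonneg_integrable mu g -> nonneg_integrable mu (fun x => f x + g x).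
Proof.
move=> [f0 fi] [g0 gi]; split; first by move=> x; rewrite addr_ge0.
exact: (integrableD measurableT fi gi).
Qed.

Lemma nonneg_integrableZ mu (k : R) f : 0 <= k ->
  nonneg_integrable mu f -> nonneg_integrable mu (fun x => k * f x).
Proof.
move=> k0 [f0 fi]; split; first by move=> x; rewrite mulr_ge0.
exact: (integrableZl measurableT k fi).
Qed.

Lemma nonneg_integrableM mu (k : R) f g : 0 <= k ->
  measurable_fun [set: X] f -> (forall x, 0 <= f x <= k) ->
  nonneg_integrable mu g -> nonneg_integrable mu (fun x => f x * g x).
Proof.
move=> k0 mf f0 gi; apply: (nonneg_integrable_le _ _ (fun x => k * g x)).
- by apply: measurable_funM => //; exact: nonneg_integrable_measurable gi.
- move=> x; have /andP[? ?] := f0 x; have g0 := gi.1 x.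
  by rewrite mulr_ge0//= ler_wpM2r.
- exact: nonneg_integrableZ.
Qed.

Lemma nonneg_integrable_cst mu (k : R) : 0 <= k ->
  (mu [set: X] < +oo)%E -> nonneg_integrable mu (cst k).
Proof.
move=> k0 muX; split => //.
apply/integrableP; split; first exact/measurable_EFinP.
by rewrite (_ : (fun _ => _) = cst `|k|%:E) ?integral_cst// lte_mul_pinfty.
Qed.

Lemma EFin_Rintegral mu f : nonneg_integrable mu f ->
  (\int[mu]_x (f x)%:E)%E = (\int[mu]_x f x)%:E.
Proof. by move=> [_ fi]; rewrite fineK//; exact: integrable_fin_num. Qed.

Lemma Rintegral_partition mu m f : finite_partition m ->
  nonneg_integrable mu f ->
  \int[mu]_x f x = \sum_(I <- fset_set m) \int[mu]_(x in I) f x.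
Proof.
move=> [fm mm [mX mI _]] fi.
(* [integral_bigsetU_EFin] wants a family that is measurable at every index. *)
pose F I := if I \in m then I else set0.
have FE I : m I -> F I = I by move=> /mem_set mI'; rewrite /F mI'.
have XE : [set: X] = \big[setU/set0]_(I <- fset_set m) F I.
  rewrite bigsetU_fset_set// -mX; apply: eq_bigcupr => I mI'; by rewrite FE.
transitivity (fine (\sum_(I <- fset_set m) \int[mu]_(x in F I) (f x)%:E)%E).
  congr fine; rewrite [in LHS]XE; apply: integral_bigsetU_EFin => //.
  - move=> I; rewrite /F; case: ifPn => [/set_mem/mm//|_].
    exact: measurable0.
  - rewrite fset_setK// => I J mI' mJ'; rewrite !FE//; exact: mI.
  - rewrite -XE; exact: (measurable_int mu (nonneg_integrable_integrable _ _ fi)).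
rewrite big_seq [RHS]big_seq -sum_fine.
  by apply: eq_bigr => I; rewrite in_fset_set// => /set_mem mI'; rewrite FE.
move=> I; rewrite in_fset_set// => /set_mem mI'; rewrite FE//.
apply: integrable_fin_num; first exact: mm.
apply: (integrableS measurableT) => //; first exact: mm.
exact: nonneg_integrable_integrable.
Qed.

Lemma Rintegral_constM mu (I : set X) f g (c : R) : measurable I ->
  nonneg_integrable mu g -> (forall x, I x -> f x = c) ->
  \int[mu]_(x in I) (f x * g x) = c * \int[mu]_(x in I) g x.
Proof.
move=> mI gi fc; rewrite -RintegralZl//.
  by apply: eq_Rintegral => x /set_mem Ix; rewrite fc.
apply: (integrableS measurableT) => //; exact: nonneg_integrable_integrable.
Qed.

End Integrals.

(** * Lower integrals of functions that may fail to be measurable *)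

Section LowerIntegral.
Context {R : realType} {d : measure_display} {T : measurableType d}.
Variable mu : {measure set T -> \bar R}.
Local Open Scope ereal_scope.
Import HBNNSimple.

Lemma le_integral_nonmeasurable (f g : T -> \bar R) :
  (forall x, 0 <= f x) -> (forall x, f x <= g x) ->
  \int[mu]_x f x <= \int[mu]_x g x.
Proof.
move=> f0 fg; rewrite !ge0_integralTE//; last first.
  by move=> x; apply: le_trans (fg x).
apply: le_ereal_sup => _ [h /= hf <-]; exists h => //= x.
exact: le_trans (fg x).
Qed.

(** The integral of a nonnegative function is the supremum over the simple
functions below it, that is, a lower integral, which is superadditive only.
Subadditivity nevertheless holds as soon as one of the two terms, here [h], is
measurable: if [phi] is simple and below [g + h], then the positive part of
[phi - h] is measurable and below [g]. *)
Lemma integral_le_addr_measurable (c : R) (f g h : T -> \bar R) :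
  (0 < c)%R ->
  (forall x, 0 <= f x) -> (forall x, 0 <= g x) -> (forall x, 0 <= h x) ->
  measurable_fun [set: T] h ->
  (forall x, c%:E * f x <= g x + h x) ->
  c%:E * \int[mu]_x f x <= \int[mu]_x g x + \int[mu]_x h x.
Proof.
move=> c0 f0 g0 h0 mh fgh.
rewrite -lee_pdivlMl// [leLHS]ge0_integralTE//.
apply: ge_ereal_sup => _ [phi /= phif <-].
rewrite lee_pdivlMl// -integralT_nnsfun.
have mphi : measurable_fun [set: T] (fun x => (phi x)%:E).
  exact/measurable_EFinP.
have phi0 x : 0 <= (phi x)%:E by rewrite lee_fin.
rewrite -ge0_integralZl_EFin//; last exact: ltW.
pose psi x := maxe (c%:E * (phi x)%:E - h x) 0.
have mpsi : measurable_fun [set: T] psi.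
  apply: measurable_maxe => //; apply: emeasurable_funB => //.
  exact: measurable_funeM.
have psi0 x : 0 <= psi x by rewrite /psi le_max lexx orbT.
apply: (@le_trans _ _ (\int[mu]_x (psi x + h x))).
  apply: ge0_le_integral => //.
  - by move=> x _; rewrite mule_ge0// lee_fin ltW.
  - exact: measurable_funeM.
  - exact: emeasurable_funD.
  - move=> x _; rewrite /psi -EFinM.
    move: (h x) (h0 x) => [r| |] //= r0.
    + by rewrite -leeBlDr// le_max lexx.
    + by rewrite addeC addye ?leey//= maxNye.
rewrite ge0_integralD// leeD2r//.
apply: le_integral_nonmeasurable => // x; rewrite /psi ge_max g0 andbT.
apply: (@le_trans _ _ (c%:E * f x - h x)).
  by apply: leeB => //; apply: lee_wpmul2l => //; rewrite lee_fin ltW.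
move: (h x) (h0 x) (fgh x) => [r| |] // r0; last by rewrite addeNy leNye.
by rewrite leeBlDr.
Qed.

End LowerIntegral.

(** * Partitions and functions that are constant on their cells *)

Section CellwiseConstant.
Context {R : realType} {d : measure_display} {X : measurableType d}.
Implicit Types (m : set (set X)) (t : X -> R).

Definition cellwise_constant m t :=
  forall I, m I -> forall x y, I x -> I y -> t x = t y.

Lemma piecewise_constant_cellwise (L0 : set (X -> R)) m t :
  finite_partition m -> piecewise_constant_model L0 m t ->
  cellwise_constant m t.
Proof.
move=> [_ _ [_ mI _]] [[a ->] _] I mIc x y Ix Iy.
apply: eq_fsbigr => J /set_mem mJ; congr (_ * _).
have inI z : I z -> \1_J z = (J == I)%:R :> R.
  move=> Iz; rewrite indicE; congr (nat_of_bool _)%:R.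
  apply/idP/eqP => [/set_mem Jz|->]; last exact/mem_set.
  by apply: mI => //; exists z.
by rewrite !inI.
Qed.

Lemma finite_partition_join m m' : finite_partition m -> finite_partition m' ->
  finite_partition (join_partition m m').
Proof.
move=> [fm mm [mX mI mne]] [fm' mm' [mX' mI' mne']].
split.
- apply: finite_setD.
  exact: (finite_image2 (fun I I' => I `&` I') fm fm').
- move=> _ [[I mIc [I' mI'c <-]] _].
  by apply: measurableI; [exact: mm|exact: mm'].
- split.
  + apply/seteqP; split => // x _.
    have : (cover m id) x by rewrite mX.
    have : (cover m' id) x by rewrite mX'.
    move=> [I' mI'c I'x] [I mIc Ix]; exists (I `&` I') => //.
    split; first by exists I => //; exists I'.
    by move=> /= E; have : (I `&` I') x by []; rewrite E.
  + move=> _ _ [[I mIc [I' mI'c <-]] _] [[J mJc [J' mJ'c <-]] _].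
    move=> [x [[Ix I'x] [Jx J'x]]].
    by congr (_ `&` _); [apply: mI => //; exists x|apply: mI' => //; exists x].
  + move=> I [_ /= I0]; exact/set0P/eqP.
Qed.

Lemma cellwise_constant_joinl m m' t :
  cellwise_constant m t -> cellwise_constant (join_partition m m') t.
Proof.
by move=> ct _ [[I mI [I' _ <-]] _] x y [Ix _] [Iy _]; exact: (ct I).
Qed.

Lemma cellwise_constant_joinr m m' t :
  cellwise_constant m' t -> cellwise_constant (join_partition m m') t.
Proof.
by move=> ct _ [[I mI [I' mI' <-]] _] x y [_ Ix] [_ Iy]; exact: (ct I').
Qed.

Lemma cellwise_constant_comp2 m t u (F : R -> R -> R) :
  cellwise_constant m t -> cellwise_constant m u ->
  cellwise_constant m (fun x => F (t x) (u x)).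
Proof.
by move=> ct cu I mI x y Ix Iy; rewrite (ct I mI x y)// (cu I mI x y).
Qed.

End CellwiseConstant.

(** * Fluctuations of the observed measure *)

Section Fluctuation.
Context {R : realType} {d : measure_display} {X : measurableType d}.
Variables (mu nu : {measure set X -> \bar R}) (s : X -> R) (m : set (set X)).
Hypotheses (fm : finite_partition m) (si : nonneg_integrable mu s).

(** The value of [chi2] at an observation [nu] of finite mass, the expected
masses being those of the measure of density [s]. *)
Definition chi2_real : R := \sum_(I <- fset_set m)
  (Num.sqrt (fine (nu I)) - Num.sqrt (\int[mu]_(x in I) s x)) ^+ 2.

(** A cell of infinite observed mass makes [chi2] infinite, so a bound on
[chi2] also tells that the observed measure is finite. *)
Lemma chi2_finite (c : R) :
  (\sum_(I \in m) (sqrte (nu I) - sqrte (\int[mu]_(x in I) (s x)%:E)) ^+ 2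
     <= c%:E)%E ->
  (nu [set: X] < +oo)%E /\ chi2_real <= c.
Proof.
have [finm mm [mX mI _]] := fm.
rewrite fsbig_finite// => hc.
have eI I : m I ->
    (\int[mu]_(x in I) (s x)%:E)%E = (\int[mu]_(x in I) s x)%:E.
  move=> mIc; rewrite fineK//; apply: integrable_fin_num; first exact: mm.
  apply: (integrableS measurableT) => //; first exact: mm.
  exact: nonneg_integrable_integrable.
have nuI I : m I -> (nu I < +oo)%E.
  move=> mIc; rewrite ltey; apply/eqP => nuI.
  move: hc; rewrite (big_fsetD1 I)/=; last by rewrite in_fset_set// mem_set.
  rewrite nuI eI//= addye ?leye_eq//.
  rewrite -ltNye (@lt_le_trans _ _ 0%E)//.
  by apply: sume_ge0 => J _; rewrite sqre_ge0.
have finI I : m I -> nu I \is a fin_num by move=> /nuI; rewrite ge0_fin_numE.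
split.
  rewrite -mX measure_fin_bigcup// fsbig_finite// big_seq.
  by apply: lte_sum_pinfty => I; rewrite in_fset_set// => /set_mem; exact: nuI.
rewrite -lee_fin (le_trans _ hc)// /chi2_real -sumEFin big_seq [leRHS]big_seq.
apply: lee_sum => I; rewrite in_fset_set// => /set_mem mIc.
by rewrite eI// -[nu I]fineK ?finI.
Qed.

(** Integrals of cellwise constant functions only see the masses of the cells,
so [cell_fluctuation] can be summed over the cells. *)
Lemma fluctuation_bound (eta : R) (p q : X -> R) :
  0 < eta -> (nu [set: X] < +oo)%E ->
  measurable_fun [set: X] p -> measurable_fun [set: X] q ->
  (forall x, 0 <= p x <= Num.sqrt 2) -> (forall x, 0 <= q x <= Num.sqrt 2) ->
  cellwise_constant m p -> cellwise_constant m q ->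
  \int[nu]_x p x + \int[mu]_x (q x * s x) <=
  \int[nu]_x q x + \int[mu]_x (p x * s x)
    + eta * \int[mu]_x ((p x - q x) ^+ 2 * s x)
    + (Num.sqrt 2 + eta^-1) * chi2_real.
Proof.
move=> eta0 nuX mp mq p0 q0 cp cq.
have [finm mm [mX _ mne]] := fm.
have [w2 w1 w32] := sqrt2_bounds R; set w := Num.sqrt 2 in w2 w1 w32 p0 q0 *.
have cst_nu (f : X -> R) : measurable_fun [set: X] f -> (forall x, 0 <= f x <= w) ->
    nonneg_integrable nu f.
  move=> mf f0; apply: (nonneg_integrable_le _ _ (cst w)) => //.
  by apply: nonneg_integrable_cst => //; lra.
pose psi x := (p x - q x) ^+ 2.
have cpsi : cellwise_constant m psi.
  exact: (cellwise_constant_comp2 _ _ _ (fun a b => (a - b) ^+ 2)).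
have mpsi : measurable_fun [set: X] psi.
  by apply: measurable_funX; exact: measurable_funB.
have psi2 x : 0 <= psi x <= 2.
  rewrite sqr_ge0 /psi; have /andP[? ?] := p0 x; have /andP[? ?] := q0 x.
  by nra.
rewrite (Rintegral_partition _ _ _ fm (cst_nu p mp p0)).
rewrite (Rintegral_partition _ _ _ fm (cst_nu q mq q0)).
have w0 : 0 <= w by lra.
rewrite (Rintegral_partition _ _ _ fm (nonneg_integrableM mu w p s w0 mp p0 si)).
rewrite (Rintegral_partition _ _ _ fm (nonneg_integrableM mu w q s w0 mq q0 si)).
rewrite (Rintegral_partition _ _ _ fm
  (nonneg_integrableM mu 2 psi s (ler0n _ 2) mpsi psi2 si)).
rewrite /chi2_real !mulr_sumr -!big_split/= big_seq [leRHS]big_seq.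
apply: ler_sum => I; rewrite in_fset_set// => /set_mem mIc.
have mI := mm _ mIc; have [x Ix] := mne _ mIc.
have nuE (f : X -> R) : cellwise_constant m f ->
    \int[nu]_(y in I) f y = f x * fine (nu I).
  move=> cf; rewrite -Rintegral_cst//; apply: eq_Rintegral => y /set_mem Iy.
  exact: (cf I).
have muE (f : X -> R) : cellwise_constant m f ->
    \int[mu]_(y in I) (f y * s y) = f x * \int[mu]_(y in I) s y.
  by move=> cf; apply: Rintegral_constM => // y Iy; exact: (cf I).
rewrite !nuE// !muE//.
apply: cell_fluctuation => //.
- by have /andP[] := p0 x.
- by have /andP[] := p0 x.
- by have /andP[] := q0 x.
- by apply: Rintegral_ge0 => y _; exact: si.1.
Qed.

End Fluctuation.

(** * The squared Hellinger distance and the score of a candidate *)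

Section Scores.
Context {R : realType} {d : measure_display} {X : measurableType d}.

Lemma measurable_cellwise_constant (m : set (set X)) (f : X -> R) :
  finite_partition m -> cellwise_constant m f -> measurable_fun [set: X] f.
Proof.
move=> [finm mm [mX _ _]] cf _ B mB; rewrite setTI.
rewrite (_ : f @^-1` B = \bigcup_(I in m `&` [set I | I `<=` f @^-1` B]) I).
  apply: fin_bigcup_measurable; first exact: finite_setIl.
  by move=> I [/mm].
apply/seteqP; split => [x Bfx|x [I [_ IB] Ix]]; last exact: IB.
have : cover m id x by rewrite mX.
move=> [I mI Ix]; exists I => //; split => // y Iy /=.
by rewrite (cf I mI y x).
Qed.

Lemma measurable_sqrt_comp (f : X -> R) : measurable_fun [set: X] f ->
  measurable_fun [set: X] (fun x => Num.sqrt (f x)).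
Proof.
move=> mf.
have ms : measurable_fun [set: R] (@Num.sqrt R).
  by apply: continuous_measurable_fun; exact: sqrt_continuous.
exact: (measurableT_comp ms mf).
Qed.

Variables mu nu : {measure set X -> \bar R}.
Implicit Types (s t u r : X -> R) (pen : (X -> R) -> R).

Lemma sqr_sqrtB_le (a b : R) : 0 <= a -> 0 <= b ->
  (Num.sqrt a - Num.sqrt b) ^+ 2 <= a + b.
Proof.
move=> a0 b0; rewrite -{2}[a]sqr_sqrtr// -{2}[b]sqr_sqrtr//.
have : 0 <= Num.sqrt a * Num.sqrt b by rewrite mulr_ge0 ?sqrtr_ge0.
by rewrite sqrrB; lra.
Qed.

Lemma hellinger2_integrable s t :
  nonneg_integrable mu s -> nonneg_integrable mu t ->
  nonneg_integrable mu (fun x => (Num.sqrt (s x) - Num.sqrt (t x)) ^+ 2).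
Proof.
move=> si ti; apply: (nonneg_integrable_le _ _ (fun x => s x + t x)).
- apply: measurable_funX; apply: measurable_funB;
  by apply: measurable_sqrt_comp; apply: nonneg_integrable_measurable; eauto.
- by move=> x; rewrite sqr_ge0 sqr_sqrtB_le ?si.1 ?ti.1.
- exact: nonneg_integrableD.
Qed.

(** [sq_hellinger] as a real number. *)
Definition hellinger2 s t : R :=
  2^-1 * \int[mu]_x (Num.sqrt (s x) - Num.sqrt (t x)) ^+ 2.

Lemma sq_hellingerE s t :
  nonneg_integrable mu s -> nonneg_integrable mu t ->
  sq_hellinger mu s t = (hellinger2 s t)%:E.
Proof.
by move=> si ti; rewrite /sq_hellinger EFin_Rintegral//; exact: hellinger2_integrable.
Qed.

Lemma hellinger2_ge0 s t : 0 <= hellinger2 s t.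
Proof.
by rewrite mulr_ge0 ?invr_ge0//; apply: Rintegral_ge0 => x _; exact: sqr_ge0.
Qed.

Lemma hellinger2C s t : hellinger2 s t = hellinger2 t s.
Proof.
congr (_ * _); apply: eq_Rintegral => x _.
by rewrite -sqrrN opprB.
Qed.

Lemma hellinger2_triangle s t u : nonneg_integrable mu s ->
  nonneg_integrable mu t -> nonneg_integrable mu u ->
  hellinger2 t u <= 2 * hellinger2 s t + 2 * hellinger2 s u.
Proof.
move=> si ti ui; rewrite /hellinger2.
have := hellinger2_integrable t u ti ui.
have hst := hellinger2_integrable s t si ti.
have hsu := hellinger2_integrable s u si ui.
set F := fun x => _; move=> hF.
have hD := nonneg_integrableD _ _ _ hst hsu.
suff : \int[mu]_x F x <= 2 * (\int[mu]_x ((Num.sqrt (s x) - Num.sqrt (t x)) ^+ 2 +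
   (Num.sqrt (s x) - Num.sqrt (u x)) ^+ 2)).
  by rewrite RintegralD//; [lra|exact: hst.2|exact: hsu.2].
rewrite -RintegralZl//; last exact: hD.2.
apply: le_Rintegral => //; [exact: hF.2| |].
  exact: (nonneg_integrableZ _ _ _ (ler0n _ 2) hD).2.
move=> x _; rewrite /F.
set a := Num.sqrt _; set b := Num.sqrt _; set c := Num.sqrt _.
have : 0 <= ((c - a) + (c - b)) ^+ 2 by exact: sqr_ge0.
by rewrite !sqrrB !sqrrD; nra.
Qed.

Lemma midpoint_ratio_le (a b : R) : 0 <= a -> 0 <= b ->
  0 <= Num.sqrt (a / ((a + b) / 2)) <= Num.sqrt 2.
Proof.
move=> a0 b0; rewrite sqrtr_ge0 ler_sqrt//.
have [->|ab0] := eqVneq (a + b) 0; first by rewrite mul0r invr0 mulr0 ler0n.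
have ab : 0 < a + b by rewrite lt_neqAle eq_sym ab0 addr_ge0.
by rewrite ler_pdivrMr; lra.
Qed.

Lemma midpoint_affinity_le (a b : R) : 0 <= a -> 0 <= b ->
  0 <= Num.sqrt (a * ((a + b) / 2)) <= a + b.
Proof.
move=> a0 b0; rewrite sqrtr_ge0/=.
rewrite -[leRHS](ger0_norm (addr_ge0 a0 b0)) -sqrtr_sqr ler_sqrt ?sqr_ge0//.
have := mulr_ge0 a0 a0; have := mulr_ge0 a0 b0; have := mulr_ge0 b0 b0.
rewrite (_ : (a + b) ^+ 2 = a * a + 2 * (a * b) + b * b); last by ring.
rewrite (_ : a * ((a + b) / 2) = (a * a) / 2 + (a * b) / 2); last by field.
lra.
Qed.

(** The quantity that [test_statistic] compares at the two candidates; as it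
depends on both of them through [r] only, exchanging the candidates changes the
sign of the test. *)
Definition score pen r t : R :=
  2^-1 * (\int[mu]_x Num.sqrt (t x * r x) + \int[nu]_x Num.sqrt (t x / r x))
  - 2^-1 * \int[mu]_x t x - pen t.

End Scores.

(** * Comparison of two candidates by the test *)

Section TestComparison.
Context {R : realType} {d : measure_display} {X : measurableType d}.
Variables (mu nu : {measure set X -> \bar R}) (m : set (set X)).
Hypothesis fm : finite_partition m.
Implicit Types (s t u r : X -> R) (pen : (X -> R) -> R).

Lemma midpoint_affinity_integrable t u :
  nonneg_integrable mu t -> nonneg_integrable mu u ->
  nonneg_integrable mu (fun x => Num.sqrt (t x * ((t x + u x) / 2))).
Proof.
move=> ti ui; apply: (nonneg_integrable_le _ _ (fun x => t x + u x)).
- have mt := nonneg_integrable_measurable _ _ ti.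
  have mu' := nonneg_integrable_measurable _ _ ui.
  apply: measurable_sqrt_comp; apply: measurable_funM => //.
  by apply: measurable_funM => //; exact: measurable_funD.
- by move=> x; apply: midpoint_affinity_le; [exact: ti.1|exact: ui.1].
- exact: nonneg_integrableD.
Qed.

Lemma rho_midpoint r t u : (forall x, r x = (t x + u x) / 2) ->
  nonneg_integrable mu t -> nonneg_integrable mu u ->
  cellwise_constant m t -> cellwise_constant m u -> (nu [set: X] < +oo)%E ->
  rho mu r nu t = (2^-1 * (\int[mu]_x Num.sqrt (t x * r x)
                          + \int[nu]_x Num.sqrt (t x / r x)))%:E.
Proof.
move=> /funext -> ti ui ct cu nuX.
have ia := midpoint_affinity_integrable t u ti ui.
 rewrite /rho EFin_Rintegral//.
have ratioE x : sqrte ((t x)%:E / ((t x + u x) / 2)%:E) =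
    (Num.sqrt (t x / ((t x + u x) / 2)))%:E.
  rewrite inver; case: ifPn => // /eqP rx0.
  have -> : t x = 0.
    by have := ti.1 x; have := ui.1 x; move: rx0; lra.
  by rewrite mul0e sqrte0 mul0r sqrtr0.
rewrite (eq_integral (fun x => (Num.sqrt (t x / ((t x + u x) / 2)))%:E)); last first.
  by move=> x _; exact: ratioE.
rewrite (EFin_Rintegral nu)//.
apply: (nonneg_integrable_le _ _ (cst (Num.sqrt 2))).
- apply: (measurable_cellwise_constant m) => //.
  exact: (cellwise_constant_comp2 _ _ _ (fun a b => Num.sqrt (a / ((a + b) / 2)))).
- by move=> x; apply: midpoint_ratio_le; [exact: ti.1|exact: ui.1].
- by apply: nonneg_integrable_cst => //; rewrite sqrtr_ge0.
Qed.

Lemma test_statisticE pen t u :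
  nonneg_integrable mu t -> nonneg_integrable mu u ->
  cellwise_constant m t -> cellwise_constant m u -> (nu [set: X] < +oo)%E ->
  let r := fun x => (t x + u x) / 2 in
  test_statistic mu pen nu t u =
    (score mu nu pen r u - score mu nu pen r t)%:E.
Proof.
move=> ti ui ct cu nuX r; rewrite /test_statistic -/r.
rewrite (EFin_Rintegral _ _ ti) (EFin_Rintegral _ _ ui).
rewrite (rho_midpoint r t u)// (rho_midpoint r u t)//.
by move=> x; rewrite /r addrC.
Qed.

Lemma test_statistic_antisym pen t u :
  nonneg_integrable mu t -> nonneg_integrable mu u ->
  cellwise_constant m t -> cellwise_constant m u -> (nu [set: X] < +oo)%E ->
  (0 <= test_statistic mu pen nu t u)%E \/ (0 <= test_statistic mu pen nu u t)%E.
Proof.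
move=> ti ui ct cu nuX; rewrite !test_statisticE// !lee_fin.
have -> : (fun x => (u x + t x) / 2) = (fun x => (t x + u x) / 2).
  by apply/funext => x; rewrite addrC.
rewrite !subr_ge0.
by case/orP: (le_total (score mu nu pen (fun x => (t x + u x) / 2) t)
  (score mu nu pen (fun x => (t x + u x) / 2) u)); [left|right].
Qed.

(** A candidate [u] preferred to [t] cannot be much farther from [s] than [t],
up to the noise [chi2_real] and the penalties.  The free parameter of
[cell_fluctuation] is taken to be [z / 6], so that the variance term costs
exactly [z] in the coefficients of the two distances. *)
Lemma preferred_hellinger_bound pen s t u (z : R) :
  0 < z -> z < 1 - Num.sqrt 2 / 2 ->
  nonneg_integrable mu s -> nonneg_integrable mu t -> nonneg_integrable mu u ->
  cellwise_constant m t -> cellwise_constant m u ->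
  (nu [set: X] < +oo)%E ->
  (0 <= test_statistic mu pen nu t u)%E ->
  (1 - Num.sqrt 2 / 2 - z) * hellinger2 mu s u + pen u <=
  (1 + Num.sqrt 2 / 2 + z) * hellinger2 mu s t + pen t
    + (Num.sqrt 2 + 6 / z) / 2 * chi2_real mu nu s m.
Proof.
move=> z0 z1 si ti ui ct cu nuX; rewrite test_statisticE// lee_fin.
set r := fun x => (t x + u x) / 2; rewrite /score.
pose p x := Num.sqrt (u x / r x); pose q x := Num.sqrt (t x / r x).
have cp : cellwise_constant m p.
  exact: (cellwise_constant_comp2 _ _ _ (fun a b => Num.sqrt (b / ((a + b) / 2)))).
have cq : cellwise_constant m q.
  exact: (cellwise_constant_comp2 _ _ _ (fun a b => Num.sqrt (a / ((a + b) / 2)))).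
have p0 x : 0 <= p x <= Num.sqrt 2.
  by rewrite /p /r addrC; apply: midpoint_ratio_le; [exact: ui.1|exact: ti.1].
have q0 x : 0 <= q x <= Num.sqrt 2.
  by apply: midpoint_ratio_le; [exact: ti.1|exact: ui.1].
have mp := measurable_cellwise_constant _ _ fm cp.
have mq := measurable_cellwise_constant _ _ fm cq.
have eta0 : 0 < z / 6 by rewrite divr_gt0.
have fluct := fluctuation_bound mu nu s m fm si (z / 6) p q eta0 nuX mp mq p0 q0 cp cq.
rewrite invf_div in fluct.
have [w2 w1 w32] := sqrt2_bounds R; set w := Num.sqrt 2 in w2 w1 w32 z1 p0 q0 fluct *.
have w0 : 0 <= w by lra.
have ips := nonneg_integrableM mu w p s w0 mp p0 si.
have iqs := nonneg_integrableM mu w q s w0 mq q0 si.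
have ipsi : nonneg_integrable mu (fun x => (p x - q x) ^+ 2 * s x).
  apply: (nonneg_integrableM _ 2) => //.
  - by apply: measurable_funX; exact: measurable_funB.
  - by move=> x; rewrite sqr_ge0 /=; have /andP[? ?] := p0 x;
      have /andP[? ?] := q0 x; nra.
have it : nonneg_integrable mu (fun x => Num.sqrt (t x * r x)).
  exact: midpoint_affinity_integrable.
have iu : nonneg_integrable mu (fun x => Num.sqrt (u x * r x)).
  rewrite (_ : (fun x => _) = (fun x => Num.sqrt (u x * ((u x + t x) / 2)))).
    exact: midpoint_affinity_integrable.
  by apply/funext => x; rewrite /r addrC.
have hst := hellinger2_integrable mu s t si ti.
have hsu := hellinger2_integrable mu s u si ui.
have B0 : 0 <= 1 - w / 2 - z by lra.
have A0 : 0 <= 1 + w / 2 + z by lra.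
have epsi := nonneg_integrableZ _ _ _ (ltW eta0) ipsi.
have eB := nonneg_integrableZ _ _ _ B0 hsu.
have eA := nonneg_integrableZ _ _ _ A0 hst.
have L1 := nonneg_integrableD _ _ _ iu ips.
have L2 := nonneg_integrableD _ _ _ L1 ti.
have L3 := nonneg_integrableD _ _ _ L2 epsi.
have L4 := nonneg_integrableD _ _ _ L3 eB.
have R1 := nonneg_integrableD _ _ _ it iqs.
have R2 := nonneg_integrableD _ _ _ R1 ui.
have R3 := nonneg_integrableD _ _ _ R2 eA.
have pointwise x : [set: X] x ->
    Num.sqrt (u x * r x) + p x * s x + t x + z / 6 * ((p x - q x) ^+ 2 * s x)
      + (1 - w / 2 - z) * (Num.sqrt (s x) - Num.sqrt (u x)) ^+ 2 <=
    Num.sqrt (t x * r x) + q x * s x + u x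
      + (1 + w / 2 + z) * (Num.sqrt (s x) - Num.sqrt (t x)) ^+ 2.
  move=> _; have := @midpoint_pointwise_bound R (z / 6) (s x) (t x) (u x)
    (ltW eta0) (si.1 x) (ti.1 x) (ui.1 x).
  by rewrite (mulrC 6) divfK.
have := le_Rintegral measurableT L4.2 R3.2 pointwise.
rewrite (RintegralD measurableT L3.2 eB.2) (RintegralD measurableT L2.2 epsi.2).
rewrite (RintegralD measurableT L1.2 ti.2) (RintegralD measurableT iu.2 ips.2).
rewrite (RintegralD measurableT R2.2 eA.2) (RintegralD measurableT R1.2 ui.2).
rewrite (RintegralD measurableT it.2 iqs.2).
rewrite (RintegralZl _ measurableT hsu.2) (RintegralZl _ measurableT hst.2).
rewrite (RintegralZl _ measurableT ipsi.2).
rewrite /hellinger2.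
move: fluct; rewrite /p /q; set K := w + 6 / z.
move: (chi2_real _ _ _ _) => chi fluct main score_le.
lra.
Qed.
End TestComparison.

(** * One random variable dominating countably many exponential tails *)

Section TailDomination.
Local Open Scope ereal_scope.
Context {R : realType} {d : measure_display} {T : measurableType d}.
Variables (P : {measure set T -> \bar R}) (I : choiceType) (M : set I).
Variables (A : I -> I -> nat -> set T) (v : I -> R).
Hypothesis M_countable : countable M.
Hypothesis mA : forall i j k, M i -> M j -> measurable (A i j k).
Hypothesis v0 : forall i, (0 <= v i)%R.
Hypothesis v_summable : \esum_(i in M) (v i)%:E < +oo.
Hypothesis PA : forall i j k, M i -> M j ->
  P (A i j k) <= (v i * v j * expR (- k%:R))%:E.

Lemma expRN_nat_le (k : nat) : (expR (- k%:R) <= 2 / (2 ^ (k + 1))%:R :> R)%R.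
Proof.
rewrite addn1 expnS natrM invfM mulrA divff// mul1r natrX expRN.
rewrite lef_pV2 ?posrE ?expR_gt0 ?exprn_gt0//.
rewrite -[X in expR X]mulr1 mulrC expRM_natr lerXn2r ?nnegrE ?expR_ge0//.
by have := expR_ge1Dx (1 : R); lra.
Qed.

Lemma sum_half_geometric : \sum_(k <oo) (2 / (2 ^ (k + 1))%:R : R)%:E = 2%:E.
Proof.
have := @cvg_geometric_eseries_half R 2 0; rewrite expr0 divr1.
exact/cvg_lim.
Qed.

Lemma term_le_nneseries (u : nat -> \bar R) n :
  (forall k, 0 <= u k) -> u n <= \sum_(k <oo) u k.
Proof.
move=> u0; rewrite (@nneseriesD1 _ u n xpredT)//.
by rewrite leeDl// nneseries_ge0.
Qed.

(** [G] counts the events [A i j k] that occur.  If all those with [k <= G]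
occurred, for some fixed [i] and [j], there would be more than [G] of them.
Counting replaces the integration of a tail function, at the cost of the factor
[2 >= sum_k exp(- k)]. *)
Lemma exponential_tails_dominated : exists G : T -> \bar R,
  [/\ measurable_fun [set: T] G, forall w, 0 <= G w,
      \int[P]_w G w <= 2%:E * (\esum_(i in M) (v i)%:E) ^+ 2 &
      forall w g, G w = g%:E -> forall i j, M i -> M j ->
        exists2 k : nat, (k%:R <= g)%R & ~ A i j k w].
Proof.
have [i0|M0] := pselect (exists i, M i); last first.
  exists (cst 0); split=> //.
  - by rewrite integral0 mule_ge0// sqre_ge0.
  - by move=> w g _ i j Mi; case: M0; exists i.
have [i_0 Mi0] := i0.
have /countable_injP[f finj] := M_countable.
(* The sums over [M] become series over [nat]: [h] inverts the injection [f] on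
   its range [B], and indices outside [B] get weight zero. *)
pose B n := n \in f @` M.
pose h n := xget i_0 [set i | M i /\ f i = n].
have hB n : B n -> M (h n) /\ f (h n) = n.
  move=> /set_mem[i Mi fi]; apply: (xgetPex i_0 (P := [set i | M i /\ f i = n])).
  by exists i.
have Bf i : M i -> B (f i) by move=> Mi; apply/mem_set; exists i.
have hf i : M i -> h (f i) = i.
  by move=> Mi; have [Mh /finj] := hB _ (Bf i Mi); apply; apply/mem_set.
pose vv n : R := if B n then v (h n) else 0%R.
have vv0 n : (0 <= vv n)%R by rewrite /vv; case: ifP.
have sumE : \sum_(n <oo) (vv n)%:E = \esum_(i in M) (v i)%:E.
  have -> : M = h @` B.
    apply/seteqP; split => [i Mi|_ [n Bn <-]]; last by have [] := hB n Bn.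
    by exists (f i); [exact: Bf|exact: hf].
  rewrite (esum_pred_image (fun i => (v i)%:E) h B)//.
  - by rewrite [RHS]eseries_mkcond; apply: eq_eseriesr => n _; rewrite /vv; case: ifP.
  - by move=> n _; rewrite lee_fin.
  - move=> m n /set_mem Bm /set_mem Bn hmn.
    by rewrite -(hB m Bm).2 -(hB n Bn).2 hmn.
pose AA i j k := if B i && B j then A (h i) (h j) k else set0.
have mAA i j k : measurable (AA i j k).
  rewrite /AA; case: ifP => // /andP[Bi Bj].
  by apply: mA; [have [] := hB i Bi|have [] := hB j Bj].
have PAA i j k : P (AA i j k) <= (vv i * (vv j * (2 / (2 ^ (k + 1))%:R)))%:E.
  rewrite /AA /vv; case: (boolP (B i)) => Bi /=; last by rewrite measure0 mul0r.
  case: (boolP (B j)) => Bj /=; last by rewrite measure0 mul0r mulr0.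
  apply: le_trans (PA _ _ _ (hB i Bi).1 (hB j Bj).1) _.
  by rewrite lee_fin mulrA ler_wpM2l ?mulr_ge0// expRN_nat_le.
pose ind i j k w : \bar R := (\1_(AA i j k) w)%:E.
have ind0 i j k w : 0 <= ind i j k w by rewrite lee_fin.
have mind i j k : measurable_fun [set: T] (ind i j k).
  by apply/measurable_EFinP; exact: measurable_indic.
pose G2 i j w := \sum_(k <oo) ind i j k w.
pose G1 i w := \sum_(j <oo) G2 i j w.
pose G w := \sum_(i <oo) G1 i w.
have G20 i j w : 0 <= G2 i j w by exact: nneseries_ge0.
have G10 i w : 0 <= G1 i w by exact: nneseries_ge0.
have mG2 i j : measurable_fun [set: T] (G2 i j) by exact: ge0_emeasurable_sum.
have mG1 i : measurable_fun [set: T] (G1 i) by exact: ge0_emeasurable_sum.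
have mG : measurable_fun [set: T] G by exact: ge0_emeasurable_sum.
exists G; split => //.
- by move=> w; exact: nneseries_ge0.
- rewrite /G integral_nneseries//.
  have S0 : 0 <= \esum_(i in M) (v i)%:E by apply: esum_ge0 => i _; rewrite lee_fin.
  move: v_summable S0 sumE; case: (\esum_(i in M) _) => [S| |]// _ S0 sumE.
  have S0' : (0 <= S)%R by rewrite -lee_fin.
  have G2le i j : \int[P]_w G2 i j w <= (2 * vv i)%:E * (vv j)%:E.
    rewrite /G2 integral_nneseries//.
    apply: (@le_trans _ _
        (\sum_(k <oo) ((vv i * vv j)%:E * (2 / (2 ^ (k + 1))%:R : R)%:E))).
      apply: lee_nneseries => k; first by move=> _ _; exact: integral_ge0.
      by move=> _; rewrite integral_indic// setIT -EFinM -mulrA.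
    rewrite nneseriesZl; last by move=> k _; rewrite lee_fin divr_ge0.
    by rewrite sum_half_geometric -!EFinM lee_fin; lra.
  have G1le i : \int[P]_w G1 i w <= (2 * S)%:E * (vv i)%:E.
    rewrite /G1 integral_nneseries//.
    apply: (@le_trans _ _ (\sum_(j <oo) ((2 * vv i)%:E * (vv j)%:E))).
      apply: lee_nneseries => j; first by move=> _ _; exact: integral_ge0.
      by move=> _; exact: G2le.
    rewrite nneseriesZl; last by move=> k _; rewrite lee_fin.
    by rewrite sumE -!EFinM lee_fin; lra.
  apply: (@le_trans _ _ (\sum_(i <oo) ((2 * S)%:E * (vv i)%:E))).
    apply: lee_nneseries => i; first by move=> _ _; exact: integral_ge0.
    by move=> _; exact: G1le.
  rewrite nneseriesZl; last by move=> k _; rewrite lee_fin.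
  by rewrite sumE -EFin_expe -!EFinM lee_fin; lra.
- move=> w g Gg i j Mi Mj; apply: contrapT => noA.
  have g0 : (0 <= g)%R by rewrite -lee_fin -Gg nneseries_ge0.
  have /andP[Kg gK] := truncn_itv g0; set K := Num.truncn g in Kg gK.
  have : (K.+1%:R)%:E <= g%:E.
    rewrite -Gg; apply: (@le_trans _ _ (G2 (f i) (f j) w)); last first.
      apply: le_trans (term_le_nneseries (fun i => G1 i w) (f i) _) => //.
      exact: (term_le_nneseries (fun j => G2 (f i) j w) (f j)).
    apply: le_trans (nneseries_lim_ge K.+1 _) => //.
    rewrite big_nat (eq_bigr (fun=> 1%:E)).
      by rewrite -big_nat sumEFin sumr_const_nat subn0.
    move=> k /andP[_ kK]; rewrite /ind indicE mem_set// /AA !Bf//= !hf//.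
    apply: contrapT => nA; apply: noA; exists k => //.
    by apply: le_trans Kg; rewrite ler_nat -ltnS.
  by rewrite lee_fin leNgt gK.
Qed.

End TailDomination.

(** * The selection rule *)

Section Selection.
Context {R : realType} {d : measure_display} {X : measurableType d}.
Variables mu nu : {measure set X -> \bar R}.
Variables (s : X -> R) (est : set (X -> R)) (pen : (X -> R) -> R).
Variables (kappa g tau : R).
Hypotheses (si : nonneg_integrable mu s) (esti : est `<=` nonneg_integrable mu).
Hypothesis pen0 : forall t, est t -> 0 <= pen t.
Hypotheses (kappa0 : 0 < kappa) (kappa1 : kappa < 1) (g0 : 0 <= g) (tau0 : 0 <= tau).
Hypothesis test_bound : forall t u, est t -> est u ->
  (0 <= test_statistic mu pen nu t u)%E ->
  kappa * hellinger2 mu s u <= 2 * hellinger2 mu s t + 2 * pen t + g.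
Hypothesis test_total : forall t u, est t -> est u ->
  (0 <= test_statistic mu pen nu t u)%E \/
  (0 <= test_statistic mu pen nu u t)%E.

Let radius t := 6 / kappa * (hellinger2 mu s t + pen t + g).

Let radius_ge0 t : est t -> 0 <= radius t.
Proof.
move=> et; rewrite /radius mulr_ge0 ?divr_ge0 ?(ltW kappa0)//.
by rewrite !addr_ge0 ?hellinger2_ge0 ?pen0.
Qed.

(** By [test_bound] a candidate preferred to [t] is close to [s], and [t] is
close to [s] when [radius t] is small; the triangle inequality then bounds their
distance. *)
Lemma selection_crit_le t : est t ->
  (selection_crit mu pen nu est t <= (radius t)%:E)%E.
Proof.
move=> et; rewrite /selection_crit; case: ifPn => [_|_].
  by rewrite lee_fin radius_ge0.
apply: ge_ereal_sup => _ [u [eu _ tu] <-].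
rewrite sq_hellingerE; [|exact: esti|exact: esti].
rewrite lee_fin; have := test_bound t u et eu tu.
have := hellinger2_triangle mu s t u si (esti _ et) (esti _ eu).
have := hellinger2_ge0 mu s t; have := pen0 t et.
set hst := hellinger2 mu s t; set hsu := hellinger2 mu s u.
set htu := hellinger2 mu t u => p0 h0 tri tb.
rewrite /radius -/hst mulrAC ler_pdivlMr//.
have := ler_wpM2r (ltW kappa0) tri.
rewrite [leRHS](_ : _ = 2 * (kappa * hst) + 2 * (kappa * hsu)); last by ring.
have : kappa * hst <= hst by rewrite ler_piMl// ltW.
by move: g0; lra.
Qed.

(** Let [t] be any candidate.  If the test prefers the selected one to [t],
their distance is at most [D(t)]; otherwise it is at most [D(shat)], which is
at most [D(t) + tau] by the selection rule. *)
Lemma selected_hellinger_bound shat :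
  est shat ->
  (forall t, est t -> (selection_crit mu pen nu est shat <=
                       selection_crit mu pen nu est t + tau%:E)%E) ->
  forall t, est t ->
  kappa / 14 * hellinger2 mu s shat <= hellinger2 mu s t + pen t + g + tau.
Proof.
move=> es sel t et.
have near : hellinger2 mu t shat <= radius t + tau.
  have [->|st] := pselect (shat = t).
    have -> : hellinger2 mu t t = 0.
      rewrite /hellinger2.
      under eq_Rintegral do rewrite subrr expr0n/=.
      by rewrite Rintegral_cst// mul0r mulr0.
    by rewrite addr_ge0 ?radius_ge0.
  rewrite -lee_fin; case: (test_total _ _ es et) => T0.
    apply: (@le_trans _ _ (selection_crit mu pen nu est shat)).
      have Et : preferred mu pen nu est shat t by split=> // ts; apply: st.
      rewrite /selection_crit; case: ifPn => [/eqP E0|_].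
        by move: Et; rewrite E0.
      rewrite hellinger2C -sq_hellingerE; [|exact: esti|exact: esti].
      by apply: ereal_sup_ubound; exists t.
    by apply: le_trans (sel t et) _; rewrite EFinD leeD2r// selection_crit_le.
  apply: (@le_trans _ _ (selection_crit mu pen nu est t)).
    have Es : preferred mu pen nu est t shat by [].
    rewrite /selection_crit; case: ifPn => [/eqP E0|_].
      by move: Es; rewrite E0.
    rewrite -sq_hellingerE; [|exact: esti|exact: esti].
    by apply: ereal_sup_ubound; exists shat.
  apply: le_trans (selection_crit_le t et) _.
  by rewrite lee_fin lerDl.
have := hellinger2_triangle mu t s shat (esti _ et) si (esti _ es).
rewrite (hellinger2C mu t s) => tri.
have h0 := hellinger2_ge0 mu s t; have p0 := pen0 t et.
move: near; rewrite /radius mulrAC -lerBlDr ler_pdivlMr//.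
set h := hellinger2 mu s t in tri h0 *; set a := hellinger2 mu t shat in tri *.
have kh : kappa * h <= h by rewrite ler_piMl// ltW.
have kt : kappa * tau <= tau by rewrite ler_piMl// ltW.
have := ler_wpM2l (ltW kappa0) tri.
rewrite [leRHS](_ : _ = 2 * (kappa * h) + 2 * (a * kappa)); last by ring.
by rewrite (mulrBl kappa a tau) (mulrC tau); move: g0 tau0; lra.
Qed.

End Selection.

(** * Measurability of the noise *)

Section Noise.
Context {R : realType} {dO : measure_display} {Om : measurableType dO}.
Context {d : measure_display} {X : measurableType d}.
Variables (N : R.-ker Om ~> X) (P : probability Om R).

Lemma measurable_sqrte_comp (f : Om -> \bar R) : (forall w, 0 <= f w)%E ->
  measurable_fun [set: Om] f -> measurable_fun [set: Om] (fun w => sqrte (f w)).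
Proof.
move=> f0 mf.
rewrite (_ : (fun w => _) = (fun w => f w `^ 2^-1)%E).
  exact: (measurableT_comp (measurable_poweR _) mf).
by apply/funext => w; rewrite poweR12_sqrt.
Qed.

Lemma measurable_chi2 (m : set (set X)) : finite_partition m ->
  measurable_fun [set: Om] (chi2 N P m).
Proof.
move=> [finm mm _].
pose F I w := (if I \in m then
  (sqrte (N w I) - sqrte (\int[P]_w' N w' I)) ^+ 2 else 0)%E.
have chi2E w : chi2 N P m w = (\sum_(I <- fset_set m) F I w)%E.
  rewrite /chi2 fsbig_finite// big_seq [RHS]big_seq; apply: eq_bigr => I.
  by rewrite in_fset_set// /F => ->.
rewrite (_ : chi2 N P m = (fun w => \sum_(I <- fset_set m) F I w)%E).
  apply: emeasurable_sum => I; rewrite /F.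
  case: (boolP (I \in m)) => [/set_mem/mm mI|_]; last exact: measurable_cst.
  have mf : measurable_fun [set: Om]
      (fun w => sqrte (N w I) - sqrte (\int[P]_w' N w' I))%E.
    apply: emeasurable_funB; last exact: measurable_cst.
    by apply: measurable_sqrte_comp => //; exact: measurable_kernel.
  exact: (emeasurable_funM mf mf).
by apply/funext.
Qed.

End Noise.

(** * The risk bound *)

(** Here [f1], [f2] are the costs [delta |m| + Delta_m] of models of the two
candidates.  The factor [2] in the hypotheses is there because an infimum is
only nearly attained; with it the noise coefficient is at most
[7 / 2 * a / z], and the constant [20] in [tau] leaves room for it. *)
Lemma noise_constant_le (R : realType) (a z f1 f2 g c pen1 pen2 : R) :
  0 < z -> z < 1 - Num.sqrt 2 / 2 -> 0 < a ->
  0 <= f1 -> 0 <= f2 -> 0 <= g ->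
  20 * a * z ^- 2 * z * f1 <= 2 * pen1 -> 20 * a * z ^- 2 * z * f2 <= 2 * pen2 ->
  c <= a * (f1 + f2 + g) ->
  (Num.sqrt 2 + 6 / z) / 2 * c <= pen1 + pen2 + 20 * a * z ^- 2 * g.
Proof.
move=> z0 z1 a0 f10 f20 g0 h1 h2 hc.
have [w2 w1 w32] := sqrt2_bounds R; set w := Num.sqrt 2 in w2 w1 w32 z1 *.
pose b := a / z.
have b0 : 0 < b by rewrite divr_gt0.
have tauE : 20 * a * z ^- 2 * z = 20 * b.
  by rewrite /b expr2; field; rewrite gt_eqF.
rewrite !tauE in h1 h2.
have K0 : 0 <= (w + 6 / z) / 2.
  by rewrite divr_ge0// addr_ge0 ?divr_ge0 ?(ltW z0)//; lra.
apply: le_trans (ler_wpM2l K0 hc) _.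
have -> : (w + 6 / z) / 2 * (a * (f1 + f2 + g)) =
    (w * z + 6) / 2 * (b * f1 + b * f2 + b * g).
  by rewrite /b; field; rewrite gt_eqF.
have wz : w * z < 1 by nra.
have wz0 : 0 < w * z by nra.
have bf1 : 0 <= b * f1 by rewrite mulr_ge0// ltW.
have bf2 : 0 <= b * f2 by rewrite mulr_ge0// ltW.
have bg : 0 <= b * g by rewrite mulr_ge0// ltW.
have tauge : 20 * (b * g) <= 20 * a * z ^- 2 * g.
  rewrite [leRHS](_ : _ = 20 * (b * g) * z^-1).
    by apply: ler_peMr; [rewrite mulr_ge0|rewrite invf_ge1//; lra].
  by rewrite /b expr2; field; rewrite gt_eqF.
apply: (@le_trans _ _ (7 / 2 * (b * f1 + b * f2 + b * g))).
  by rewrite ler_wpM2r ?addr_ge0//; lra.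
by rewrite -(mulrA 20 b f1) in h1; rewrite -(mulrA 20 b f2) in h2; lra.
Qed.

Lemma exists_near_inf (R : realType) (F : set R) : F !=set0 ->
  (forall x, F x -> 1 <= x) -> exists2 x, F x & x <= 2 * inf F.
Proof.
move=> F0 F1; have lb : lbound F 1 by move=> x /F1.
have inf1 : 1 <= inf F by exact: lb_le_inf.
have [x Fx xlt] := @inf_adherent R F (inf F) (lt_le_trans ltr01 inf1)
  (conj F0 (ex_intro _ 1 lb)).
by exists x => //; lra.
Qed.


Theorem theorem3 (R : realType) (z : R)
    (z_gt0 : 0 < z) (z_lt : z < 1 - 1 / Num.sqrt 2) :
  exists2 C : R, 0 < C &
  forall (dO : measure_display) (Om : measurableType dO) (P : probability Om R)
    (d : measure_display) (X : measurableType d)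
    (mu : {measure set X -> \bar R})
    (N : R.-ker Om ~> X) (s : X -> R) (L0 : set (X -> R))
    (M : set (set (set X))) (a delta tau : R) (Delta : set (set X) -> R)
    (pen : (X -> R) -> R)
    (Lam : countType) (shat : Lam -> Om -> X -> R) (lhat : Om -> Lam),
    (* the setting *)
    L0 `<=` nonneg_integrable mu ->
    L0 s ->
    (forall A, measurable A ->
       (\int[P]_w N w A = \int[mu]_(x in A) (s x)%:E)%E /\
       (\int[mu]_(x in A) (s x)%:E < +oo)%E) ->
    countable M ->
    (forall m, M m -> finite_partition m) ->
    (forall m, M m -> piecewise_constant_model L0 m !=set0) ->
    (* the assumptions of the theorem *)
    0 < a ->
    (forall (xi : R) (m : set (set X)), 0 < xi -> finite_partition m ->
       (P [set w | (a * ((ncells m)%:R + xi))%:E <= chi2 N P m w]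
          <= (expR (- xi))%:E)%E) ->
    1 <= delta ->
    (forall m m', M m -> M m' ->
       (ncells (join_partition m m'))%:R
         <= delta * (maxn (ncells m) (ncells m'))%:R) ->
    tau = 20 * a * z ^- 2 ->
    (\esum_(m in M) (expR (- Delta m))%:E < +oo)%E ->
    (forall m, M m -> 1 <= Delta m) ->
    (forall l, is_estimator N (shat l)) ->
    (forall l w, all_models L0 M (shat l w)) ->
    (forall t, all_models L0 M t -> 0 <= pen t) ->
    (forall t, all_models L0 M t ->
       z * tau * inf [set delta * (ncells m)%:R + Delta m |
                        m in models_containing L0 M t] <= pen t) ->
    is_selected N mu pen tau shat lhat ->
    (* the risk bound *)
    (C%:E * \int[P]_w sq_hellinger mu s (shat (lhat w) w)
       <= \int[P]_w ereal_inf [set sq_hellinger mu s (shat l w)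
                                   + (pen (shat l w))%:E | l in [set: Lam]]
          + tau%:E * maxe ((\esum_(m in M) (expR (- Delta m))%:E) ^+ 2) 1)%E.


Proof.
have [w2 w1 w32] := sqrt2_bounds R.
have z_lt2 : z < 1 - Num.sqrt 2 / 2.
  suff <- : 1 / Num.sqrt 2 = Num.sqrt 2 / 2 :> R by [].
  by rewrite -{3}w2; field; lra.
pose kappa := 1 - Num.sqrt 2 / 2 - z.
have kappa0 : 0 < kappa by rewrite subr_gt0.
have kappa1 : kappa < 1 by rewrite /kappa; lra.
(* [kappa / 14] comes from [selected_hellinger_bound]; the additional factor
   [3] compensates [1 + E G <= 1 + 2 Sigma^2 <= 3 max(Sigma^2, 1)]. *)
exists (kappa / 42); first by rewrite divr_gt0.
move=> dO Om P d X mu N s L0 M a delta tau Delta pen Lam shat lhat.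
move=> L0_int L0s intensity M_countable M_part M_ne a0 tail delta1 join_card.
move=> tauE Delta_summable Delta1 _ shat_model pen0 pen_lb selected.
have si : nonneg_integrable mu s by exact: L0_int.
have tau0 : 0 < tau by rewrite tauE !mulr_gt0// invr_gt0 exprn_gt0.
pose weight m := expR (- Delta m).
pose level m m' (k : R) :=
  (a * ((ncells (join_partition m m'))%:R + (Delta m + Delta m' + k)))%:E.
pose A m m' k := [set w | (level m m' k%:R <= chi2 N P (join_partition m m') w)%E].
have mA m m' k : M m -> M m' -> measurable (A m m' k).
  move=> Mm Mm'; rewrite /A -[X in measurable X]setTI.
  apply: emeasurable_fun_c_infty => //; apply: measurable_chi2.
  by apply: finite_partition_join; exact: M_part.
have PA m m' k : M m -> M m' ->
    (P (A m m' k) <= (weight m * weight m' * expR (- k%:R))%:E)%E.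
  move=> Mm Mm'; apply: le_trans (tail _ _ _ _) _.
  - have := Delta1 m Mm; have := Delta1 m' Mm'; have : 0 <= k%:R :> R by [].
    lra.
  - by apply: finite_partition_join; exact: M_part.
  - by rewrite /weight -!expRD -!opprD.
have [G [mG G0 intG GA]] := exponential_tails_dominated P _ M A weight
  M_countable mA (fun m => expR_ge0 _) Delta_summable PA.
have model_int t : all_models L0 M t -> nonneg_integrable mu t.
  by move=> [m Mm [_ L0t]]; exact: L0_int.
pose cost m := delta * (ncells m)%:R + Delta m.
have cost1 m : M m -> 1 <= cost m.
  move=> Mm; have := Delta1 m Mm.
  have : 0 <= delta * (ncells m)%:R by rewrite mulr_ge0//; lra.
  by rewrite /cost; lra.
have best_model t : all_models L0 M t ->
    exists m, [/\ M m, cellwise_constant m t & z * tau * cost m <= 2 * pen t].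
  move=> tM; have [m0 Mm0 tm0] := tM.
  have [||x [m [Mm tm] <-] le_inf] := @exists_near_inf R
      [set cost m | m in models_containing L0 M t].
  - by exists (cost m0), m0.
  - by move=> _ [m [Mm _] <-]; exact: cost1.
  exists m; split=> //.
    exact: piecewise_constant_cellwise (M_part m Mm) tm.
  apply: (@le_trans _ _ (2 * (z * tau * inf
      [set cost m | m in models_containing L0 M t]))).
    by rewrite mulrCA ler_wpM2l// mulr_ge0 ?ltW.
  by rewrite ler_wpM2l// pen_lb.
(* The join of a nearly optimal model of [t] and one of [u], on which the noise
   is paid for by the two penalties. *)
have noise w g : G w = g%:E -> forall t u,
    all_models L0 M t -> all_models L0 M u ->
    exists m, [/\ finite_partition m, cellwise_constant m t,
      cellwise_constant m u, (N w [set: X] < +oo)%E &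
      (Num.sqrt 2 + 6 / z) / 2 * chi2_real mu (N w) s m
        <= pen t + pen u + tau * g].
  move=> Gw t u tM uM.
  have g0 : 0 <= g by rewrite -lee_fin -Gw.
  have [m1 [Mm1 tm1 cost_t]] := best_model t tM.
  have [m2 [Mm2 um2 cost_u]] := best_model u uM.
  have fm : finite_partition (join_partition m1 m2).
    by apply: finite_partition_join; exact: M_part.
  have [k kg nA] := GA w g Gw m1 m2 Mm1 Mm2.
  have chi_le : (chi2 N P (join_partition m1 m2) w <= level m1 m2 g)%E.
    move/negP: nA; rewrite -ltNge => /ltW/le_trans; apply.
    by rewrite lee_fin ler_pM2l// !lerD2l.
  have [|nuX chi_real] := chi2_finite mu (N w) s _ fm si
      (a * ((ncells (join_partition m1 m2))%:R + (Delta m1 + Delta m2 + g))).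
    apply: le_trans chi_le; rewrite /chi2.
    rewrite le_eqVlt; apply/orP; left; apply/eqP.
    apply: eq_fsbigr => I /set_mem mI; rewrite (intensity I _).1//.
    by have [_ /(_ I mI)] := fm.
  exists (join_partition m1 m2); split=> //.
  - exact: cellwise_constant_joinl.
  - exact: cellwise_constant_joinr.
  rewrite tauE; apply: (noise_constant_le _ a z (cost m1) (cost m2)) => //.
  - exact: (le_trans ler01 (cost1 _ Mm1)).
  - exact: (le_trans ler01 (cost1 _ Mm2)).
  - by move: cost_t; rewrite tauE (mulrC z).
  - by move: cost_u; rewrite tauE (mulrC z).
  apply: le_trans chi_real _; rewrite ler_pM2l// /cost.
  have := join_card m1 m2 Mm1 Mm2.
  have : delta * (maxn (ncells m1) (ncells m2))%:R <=
      delta * ((ncells m1)%:R + (ncells m2)%:R).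
    rewrite -natrD ler_wpM2l//; first lra.
    by rewrite ler_nat geq_max leq_addr leq_addl.
  by rewrite mulrDr; lra.
have pointwise w g : G w = g%:E -> forall l,
    kappa / 14 * hellinger2 mu s (shat (lhat w) w) <=
    hellinger2 mu s (shat l w) + pen (shat l w) + tau * g + tau.
  move=> Gw l; have g0 : 0 <= g by rewrite -lee_fin -Gw.
  have estM t : range (fun l => shat l w) t -> all_models L0 M t.
    by move=> [l' _ <-]; exact: shat_model.
  apply: (@selected_hellinger_bound R d X mu (N w) s
    (range (fun l => shat l w)) pen kappa (tau * g) tau) => //.
  - by move=> t /estM; exact: model_int.
  - by move=> t /estM; exact: pen0.
  - by rewrite mulr_ge0// ltW.
  - exact: ltW.
  - move=> t u /estM tM /estM uM T0.
    have [m [fm tm um nuX noise_le]] := noise w g Gw t u tM uM.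
    have := preferred_hellinger_bound mu (N w) m fm pen s t u z z_gt0 z_lt2
      si (model_int t tM) (model_int u uM) tm um nuX T0.
    have : (1 + Num.sqrt 2 / 2 + z) * hellinger2 mu s t <= 2 * hellinger2 mu s t.
      by rewrite ler_wpM2r ?hellinger2_ge0//; lra.
    by rewrite -/kappa; lra.
  - move=> t u /estM tM /estM uM.
    have [m [fm tm um nuX _]] := noise w g Gw t u tM uM.
    exact: (test_statistic_antisym mu (N w) m fm pen t u (model_int t tM)
      (model_int u uM) tm um nuX).
  - by move=> _ [l' _ <-]; exact: selected.
pose h w := ((tau / 3)%:E * (1 + G w))%E.
have h0 w : (0 <= h w)%E.
  by rewrite mule_ge0 ?lee_fin ?divr_ge0 ?(ltW tau0)// adde_ge0.
have mh : measurable_fun [set: Om] h.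
  by apply: measurable_funeM; apply: emeasurable_funD.
pose risk w := (ereal_inf [set sq_hellinger mu s (shat l w)
                                   + (pen (shat l w))%:E | l in [set: Lam]])%E.
have sqE w l : sq_hellinger mu s (shat l w) = (hellinger2 mu s (shat l w))%:E.
  by apply: sq_hellingerE => //; exact: model_int.
have risk0 w : (0 <= risk w)%E.
  apply: le_ereal_inf_tmp => _ [l _ <-].
  by rewrite sqE -EFinD lee_fin addr_ge0 ?hellinger2_ge0 ?pen0.
have risk_le w : ((kappa / 42)%:E * sq_hellinger mu s (shat (lhat w) w)
    <= risk w + h w)%E.
  rewrite /h; case Gw : (G w) (G0 w) => [g| |]// g0; last first.
    by rewrite addey// gt0_muley ?lte_fin ?divr_gt0// addey ?leey// -ltNye
      (lt_le_trans _ (risk0 w)).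
  rewrite sqE -!EFinM -leeBlDr//; apply: le_ereal_inf_tmp => _ [l _ <-].
  rewrite sqE -!EFinD lee_fin; have := pointwise w g Gw l.
  have := hellinger2_ge0 mu s (shat l w); have := pen0 _ (shat_model l w).
  rewrite (_ : kappa / 42 = kappa / 14 / 3); last by field.
  move: (hellinger2 _ _ _) (hellinger2 _ _ _) => x y; lra.
apply: le_trans (integral_le_addr_measurable P _ _ risk h _ _ risk0 h0 mh risk_le) _.
- by rewrite divr_gt0.
- by move=> w; rewrite sqE lee_fin hellinger2_ge0.
apply: leeD => //.
rewrite ge0_integralZl//; [|exact: emeasurable_funD|by move=> w _; rewrite adde_ge0
  |by rewrite lee_fin divr_ge0// ltW].
rewrite ge0_integralD//.
have -> : (\int[P]_w 1 = 1)%E by rewrite integral_cst// mul1e; exact: probability_setT.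
have Delta_ge0 : (0 <= \esum_(m in M) (expR (- Delta m))%:E)%E.
  by apply: esum_ge0 => m _; rewrite lee_fin expR_ge0.
move: intG Delta_summable Delta_ge0; rewrite /weight.
case: (\esum_(m in M) _)%E => [S| |]// intG _ _.
have tau3 : (0 <= (tau / 3)%:E)%E by rewrite lee_fin divr_ge0// ltW.
apply: le_trans (lee_wpmul2l tau3 (leeD2l 1%E intG)) _.
rewrite -EFin_expe -EFin_max -!EFinM lee_fin.
rewrite -[leLHS]mulrA ler_wpM2l ?(ltW tau0)//.
have S2max : S ^+ 2 <= Num.max (S ^+ 2) 1 by rewrite le_max lexx.
have one_max : 1 <= Num.max (S ^+ 2) 1 by rewrite le_max lexx orbT.
by lra.
Qed.
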